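(* Let $\pi$ be the equilibrium (stationary) distribution of the Markov process $(X_s)$, let $t$ be a lag time, and let $A$ (reactant) and $B$ (product) be two sets in phase space. Consider estimating the committor by minimizing the functional $$V[v]=\mathbb E_{\pi}\left[(v(X_t)-v(X_0))^2\right]$$ over functions $v$ restricted to be $1$ on $B$ and $0$ on $A$. If the committor is parameterized as a sum of indicator functions of Markov states $S_1,\dots,S_K$, i.e. $v(x)=\sum_{j=1}^K v_j\mathbb 1_{S_j}(x)$, then minimizing $V$ is mathematically equivalent to sampling initial points from the equilibrium measure $\pi$, constructing a Markov state model with states $S_j$, and computing its committor.
   Context: $(X_s)$ is a discrete-time Markov process on a phase space, taking a step every $\Delta t$ time units according to a time-invariant transition probability density. Its transition operator is $\mathcal K^{t}f(x)=\mathbb E[f(X_t)\mid X_0=x]$, and $\mathbb E_\pi$ denotes expectation with $X_0$ distributed according to $\pi$. The (forward) committor of the process is the probability, starting from $x$, of reaching $B$ before $A$. The Markov states $S_1,\dots,S_K$ are disjoint sets subdividing phase space, each wholly contained in $A$, in $B$, or in neither. The Markov state model with states $S_j$, lag time $t$ and initial points sampled from $\pi$ has transition matrix $$T_{ij}=\frac{\int \mathbb 1_{S_i}(x)\,\mathcal K^{t}\mathbb 1_{S_j}(x)\,\pi(x)\,dx}{\int \mathbb 1_{S_i}(x)\,\pi(x)\,dx}.$$ The committor of the Markov state model is the vector $(q_i)_{i=1}^K$ given by $q_i=\sum_{j=1}^K T_{ij}q_j$ for states $S_i$ contained in neither $A$ nor $B$, $q_i=1$ for states $S_i$ in $B$,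 and $q_i=0$ for states $S_i$ in $A$; the corresponding approximation of the committor in phase space is $\sum_j q_j\mathbb 1_{S_j}(x)$.
   Formalization: The equilibrium distribution is assumed to satisfy detailed balance (a reversible process), not stationarity alone; for a merely stationary process, such as a cyclic chain on four states, the minimizer of V differs from the Markov state model's committor. *)

(* Defs.v *)
From HB Require Import structures.
From mathcomp Require Import all_boot all_order all_algebra.
From mathcomp Require Import all_classical all_reals all_analysis.

Set Implicit Arguments.
Unset Strict Implicit.
Unset Printing Implicit Defensive.

Import Order.TTheory GRing.Theory Num.Theory.
Import numFieldNormedType.Exports.

Local Open Scope classical_set_scope.
Local Open Scope ring_scope.

(* The phase space is an arbitrary measurable space [E].  Transition
   densities p(x, y) dy and distributions pi(x) dx are replaced by the
   probability kernel [P] and the probability measure [pi] they induce, which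
   need not have a density.  Time is counted in steps: the lag time t is
   [n] time steps. *)

Section process.
Context {dE dO : measure_display} {R : realType}
  {E : measurableType dE} {Omega : measurableType dO}.

(* [Pr x] is the law of the process started at [x], and [Pr] is measurable in
   [x].  The first clause is X_0 = x almost surely, stated through the law of
   X_0 because singletons need not be measurable. *)
Definition markov_process (P : R.-pker E ~> E) (Pr : R.-pker E ~> Omega)
    (X : nat -> {mfun Omega >-> E}) : Prop :=
  (forall x (C : set E), measurable C -> Pr x (X 0%N @^-1` C) = (\d_x C)%E) /\
  (forall x (m : nat) (C : nat -> set E) (D : set E),
    (forall k, measurable (C k)) -> measurable D ->
    let past := [set w | forall k, (k <= m)%N -> C k (X k w)] in
    Pr x (past `&` X m.+1 @^-1` D) = (\int[Pr x]_(w in past) P (X m w) D)%E).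

Definition stationary (P : R.-pker E ~> E) (pi : probability E R) : Prop :=
  forall C : set E, measurable C -> (\int[pi]_x P x C)%E = pi C.

(* Detailed balance pi(dx) P(x, dy) = pi(dy) P(y, dx), that is
   pi(x) p(x, y) = pi(y) p(y, x) almost everywhere when densities exist. *)
Definition detailed_balance (P : R.-pker E ~> E) (pi : probability E R) :
    Prop :=
  forall C D : set E, measurable C -> measurable D ->
    (\int[pi]_(x in C) P x D)%E = (\int[pi]_(x in D) P x C)%E.

(* Equilibrium in the sense of statistical mechanics.  The first clause follows
   from the second; without the second, minimizing [dirichlet] yields the
   committor of the symmetrized Markov state model instead. *)
Definition equilibrium (P : R.-pker E ~> E) (pi : probability E R) : Prop :=
  stationary P pi /\ detailed_balance P pi.

Definition transition_operator (Pr : R.-pker E ~> Omega)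
    (X : nat -> {mfun Omega >-> E}) (n : nat) (f : E -> R) : E -> R :=
  fun x => \int[Pr x]_w f (X n w).

(* Expectation with X_0 distributed according to [pi]. *)
Definition expectation_from (Pr : R.-pker E ~> Omega) (pi : probability E R)
    (Y : Omega -> R) : \bar R :=
  (\int[pi]_x \int[Pr x]_w (Y w)%:E)%E.

(* The functional V. *)
Definition dirichlet (Pr : R.-pker E ~> Omega)
    (X : nat -> {mfun Omega >-> E}) (pi : probability E R) (n : nat)
    (v : E -> R) : \bar R :=
  expectation_from Pr pi (fun w => (v (X n w) - v (X 0%N w)) ^+ 2).

End process.

Section markov_state_model.
Context {d : measure_display} {R : realType} {E : measurableType d}.

Definition outside (A B C : set E) : Prop := C `&` (A `|` B) = set0.

Definition markov_states (A B : set E) (K : nat) (S : 'I_K -> set E) : Prop :=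
  [/\ forall j, measurable (S j),
      forall j, S j !=set0,
      trivIset [set: 'I_K] S,
      \bigcup_j S j = [set: E] &
      forall j, [\/ S j `<=` A, S j `<=` B | outside A B (S j)]].

Definition indicator_sum (K : nat) (S : 'I_K -> set E) (c : 'cV[R]_K) : E -> R :=
  fun x => \sum_(j < K) c j 0 * \1_(S j) x.

(* [Kt] is the transition operator at the lag time. *)
Definition msm_matrix (Kt : (E -> R) -> (E -> R)) (pi : probability E R)
    (K : nat) (S : 'I_K -> set E) : 'M[R]_K :=
  \matrix_(i < K, j < K)
    ((\int[pi]_x (\1_(S i) x * Kt (\1_(S j)) x)) / (\int[pi]_x \1_(S i) x)).

Definition msm_committor (A B : set E) (K : nat) (S : 'I_K -> set E)
    (T : 'M[R]_K) (q : 'cV[R]_K) : Prop :=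
  forall i, [/\ S i `<=` A -> q i 0 = 0,
                S i `<=` B -> q i 0 = 1 &
                outside A B (S i) -> q i 0 = \sum_(j < K) T i j * q j 0].

Definition trial_functions (A B : set E) (K : nat) (S : 'I_K -> set E) :
    set (E -> R) :=
  [set v | [/\ exists c, v = indicator_sum S c,
               forall x, A x -> v x = 0 & forall x, B x -> v x = 1]].

Definition is_minimizer (U : Type) (D : set U) (F : U -> \bar R) (u : U) :
    Prop :=
  D u /\ forall w, D w -> (F u <= F w)%E.

End markov_state_model.

(* Main.v *)
(** Write m_ij for the probability that X_0 lies in S_i and X_n in S_j when X_0
    has law pi.  On v = sum_j v_j 1_(S_j) the functional V is the quadratic form
    sum_ij m_ij (v_j - v_i)^2, and detailed balance for one step propagates to n
    steps, so m is symmetric.  By convexity, v minimizes this form under the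
    boundary constraints iff its derivative vanishes in each free coordinate,
    i.e. sum_j m_ij (v_j - v_i) = 0; dividing by sum_j m_ij = pi(S_i) this is
    the committor equation v_i = sum_j T_ij v_j. *)

Require Import Defs.
From HB Require Import structures.
From mathcomp Require Import all_boot all_order all_algebra.
From mathcomp Require Import all_classical all_reals all_analysis.
From mathcomp Require Import finmap measurable_realfun ring lra.

Import Order.TTheory GRing.Theory Num.Theory.
Import numFieldNormedType.Exports.

Local Open Scope classical_set_scope.
Local Open Scope ring_scope.

(** * Quadratic energy of a symmetric weight matrix and its constrained minimizers *)

Section edge_energy.
Context {R : realFieldType} {K : nat}.
Implicit Types (M : 'M[R]_K) (c q h : 'cV[R]_K).

(** The Dirichlet form of a weighted graph on the states. The sum runs over ordered pairs, so each
    edge is counted in both directions. *)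
Definition edge_energy M c : R :=
  \sum_i \sum_j (c j 0 - c i 0) ^+ 2 * M i j.

Lemma edge_energy_ge0 M c : (forall i j, 0 <= M i j) -> 0 <= edge_energy M c.
Proof.
move=> M0; apply: sumr_ge0 => i _; apply: sumr_ge0 => j _.
by rewrite mulr_ge0 ?sqr_ge0.
Qed.

Lemma edge_energyZ M r c : edge_energy M (r *: c) = r ^+ 2 * edge_energy M c.
Proof.
rewrite mulr_sumr; apply: eq_bigr => i _; rewrite mulr_sumr.
by apply: eq_bigr => j _; rewrite !mxE; ring.
Qed.

(** Discrete integration by parts. The cross term of the square is twice the sum of [M i j * (q j 0
    - q i 0) * (h j 0 - h i 0)]; swapping the indices, by symmetry of [M], makes the [h j 0] half
    equal to the [- h i 0] half, whence the factor 4. *)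
Lemma edge_energyD M q h : M^T = M ->
  edge_energy M (q + h) = edge_energy M q + edge_energy M h
    - 4 * \sum_i h i 0 * \sum_j M i j * (q j 0 - q i 0).
Proof.
move=> symM; set cross := \sum_i _.
have -> : edge_energy M (q + h) = edge_energy M q + edge_energy M h +
    2 * (\sum_i \sum_j h j 0 * (M i j * (q j 0 - q i 0))) - 2 * cross.
  rewrite /edge_energy /cross !mulr_sumr -sumrN -!big_split/=.
  apply: eq_bigr => i _.
  rewrite !mulr_sumr -sumrN -!big_split/=.
  by apply: eq_bigr => j _; rewrite !mxE; ring.
have -> : \sum_i \sum_j h j 0 * (M i j * (q j 0 - q i 0)) = - cross.
  rewrite exchange_big /cross -sumrN; apply: eq_bigr => i _ /=.
  rewrite mulr_sumr -sumrN; apply: eq_bigr => j _.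
  by rewrite -{1}symM mxE; ring.
by ring.
Qed.

(** For necessity, [q] is perturbed along one free coordinate. For sufficiency, [c - q] vanishes at
    the coordinates that are not free and the sums vanish at the free ones, so the cross term
    disappears and the excess energy is that of [c - q]. *)
Lemma edge_energy_minimizerP M (free : 'I_K -> Prop) q :
  (forall i j, 0 <= M i j) -> M^T = M ->
  (forall c, (forall i, ~ free i -> c i 0 = q i 0) ->
    edge_energy M q <= edge_energy M c) <->
  (forall i, free i -> \sum_j M i j * (q j 0 - q i 0) = 0).
Proof.
move=> M0 symM; split=> [qmin i fi|qharm c cq].
- set G := \sum_j _; pose e : 'cV[R]_K := delta_mx i 0.
  have crossE r :
      \sum_k (r *: e) k 0 * (\sum_j M k j * (q j 0 - q k 0)) = r * G.
    rewrite (bigD1 i)//= [X in _ + X]big1 => [|k ki].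
      by rewrite addr0 !mxE !eqxx mulr1.
    by rewrite !mxE (negbTE ki) mulr0 mul0r.
  have := edge_energy_ge0 _ e M0; set a := edge_energy M e => a0.
  (* A step of size s changes the energy by s^2 a - 4 s G. With s = G / (a + 1) this is - s^2 (3 a +
     4), which minimality allows only for s = 0. Adding 1 keeps the denominator positive when a =
     0. *)
  have : edge_energy M q <= edge_energy M (q + (G / (a + 1)) *: e).
    apply: qmin => k nfk; rewrite !mxE; case: eqVneq => [ki|_]; last first.
      by rewrite mulr0 addr0.
    by rewrite -ki in fi.
  rewrite edge_energyD// edge_energyZ crossE -/a.
  set s := G / (a + 1) => H.
  have sG : G = s * (a + 1) by rewrite divfK// gt_eqF// ltr_wpDl.
  have s0 : s = 0.
    apply/eqP; rewrite -sqrf_eq0 eq_le sqr_ge0 andbT.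
    move: H; rewrite sG => H.
    have : 0 <= s ^+ 2 * a by rewrite mulr_ge0// sqr_ge0.
    nra.
  by rewrite sG s0 mul0r.
- rewrite -[c](subrK q) addrC edge_energyD// [X in 4 * X]big1 => [|i _].
    by rewrite mulr0 subr0 lerDl edge_energy_ge0.
  have [fi|nfi] := pselect (free i); first by rewrite qharm ?mulr0.
  by rewrite !mxE cq// subrr mul0r.
Qed.

End edge_energy.

(** * Induction principle for nonnegative measurable functions *)

Section ge0_measurable_ind.
Local Open Scope ereal_scope.
Import HBNNSimple.

(** A nonnegative measurable function is an increasing limit of simple functions, and each of these
    is a finite nonnegative combination of indicators of its level sets. *)
Lemma ge0_measurable_ind {d} {T : measurableType d} {R : realType}
    (Q : (T -> \bar R) -> Prop) :
  (forall A, measurable A -> Q (EFin \o \1_A)) ->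
  (forall (r : R) (f : T -> \bar R), (0 <= r)%R -> (forall x, 0 <= f x) ->
    measurable_fun [set: T] f -> Q f -> Q (fun x => r%:E * f x)) ->
  (forall f g : T -> \bar R,
    (forall x, 0 <= f x) -> measurable_fun [set: T] f ->
    (forall x, 0 <= g x) -> measurable_fun [set: T] g ->
    Q f -> Q g -> Q (fun x => f x + g x)) ->
  (forall f : nat -> T -> \bar R, (forall n x, 0 <= f n x) ->
    (forall n, measurable_fun [set: T] (f n)) ->
    (forall x, nondecreasing_seq (f ^~ x)) ->
    (forall n, Q (f n)) -> Q (fun x => limn (f ^~ x))) ->
  forall f, (forall x, 0 <= f x) -> measurable_fun [set: T] f -> Q f.
Proof.
move=> Q1 QZ QD Qlim f f0 mf.
pose f_ := nnsfun_approx measurableT mf.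
have -> : f = fun x => limn (fun n => (f_ n x)%:E).
  by apply/funext => x; apply/esym/cvg_lim => //; exact: cvg_nnsfun_approx.
apply: (Qlim (fun n x => (f_ n x)%:E)).
- by move=> n x; rewrite lee_fin.
- by move=> n; exact/measurable_EFinP.
- by move=> x m n mn; rewrite lee_fin; exact/lefP/nd_nnsfun_approx.
move=> n; move: (f_ n) => {f_ f0 mf Qlim} h.
have -> : (fun x => (h x)%:E) =
    fun x => \sum_(y <- fset_set (range h)) y%:E * (\1_(h @^-1` [set y]) x)%:E.
  apply/funext => x; rewrite {1}(fimfunE h) fsbig_finite//= -sumEFin.
  by apply: eq_bigr => y _; rewrite EFinM.
have: forall y, y \in enum_fset (fset_set (range h)) -> (0 <= y)%R.
  by move=> y; rewrite -[_ \in _]/(y \in fset_set (range h)) in_fset_set//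
    => /set_mem[x _ <-].
elim: (enum_fset (fset_set (range h))) => [_|y s ih ys0].
  (* The zero function enters as the indicator of the empty set. *)
  have -> : (fun x : T => \sum_(y <- [::]) y%:E * (\1_(h @^-1` [set y]) x)%:E)
      = EFin \o \1_set0.
    by apply/funext => x /=; rewrite big_nil indic0.
  exact: Q1.
under eq_fun do rewrite big_cons.
have ys z : z \in s -> (0 <= z)%R.
  by move=> zs; apply: ys0; rewrite in_cons zs orbT.
have m1 z :
    measurable_fun [set: T] (fun x => (\1_(h @^-1` [set z]) x)%:E : \bar R).
  by apply/measurable_EFinP; exact: measurable_indic.
have y0 : (0 <= y)%R by apply: ys0; rewrite mem_head.
apply: QD.
- by move=> x; rewrite mule_ge0// lee_fin.
- exact: measurable_funeM.
- move=> x; rewrite big_seq; apply: sume_ge0 => z zs.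
  by rewrite mule_ge0// lee_fin ?ys.
- by apply: emeasurable_sum => z; exact: measurable_funeM.
- by apply: QZ => //; exact: Q1.
- exact: ih.
Qed.

End ge0_measurable_ind.

(** * Weighted integration through a kernel *)

Section kernel_integral.
Local Open Scope ereal_scope.

(** The delicate case is an infinite [c]: either [u] is identically 0 and so are both sides, or [u]
    is positive from some rank on and both sides are infinite. *)
Lemma ge0_nondecreasing_limeMl {R : realType} (c : \bar R) (u : (\bar R)^nat) :
  0 <= c -> (forall n, 0 <= u n) -> nondecreasing_seq u ->
  limn (fun n => c * u n) = c * limn u.
Proof.
move=> c0 u0 ndu; have cu := ereal_nondecreasing_is_cvgn ndu.
case: c c0 => [r r0| _|//]; first by rewrite limeMl.
have [u_eq0|] := pselect (forall n, u n = 0).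
  have -> : u = cst 0 by apply/funext.
  by under eq_fun do rewrite /= mule0; rewrite !lim_cst// mule0.
move=> /existsNP[N /eqP uN].
have uN0 : 0 < u N by rewrite lt0e uN u0.
rewrite gt0_mulye; last first.
  rewrite (lt_le_trans uN0)// (cvg_lim _ (ereal_nondecreasing_cvgn ndu))//.
  by apply: ereal_sup_ubound; exists N.
apply/cvg_lim => //; apply: cvg_near_cst; exists N => // n /= Nn.
by rewrite gt0_mulye// (lt_le_trans uN0)// ndu.
Qed.

Local Open Scope ereal_scope.
Section kernel_functional.
Context {dX dY : measure_display} {X : measurableType dX}
  {Y : measurableType dY} {R : realType}.
Variables (mu : {measure set X -> \bar R}) (g : X -> \bar R)
  (k : X -> {measure set Y -> \bar R}).
Hypotheses (g0 : forall x, 0 <= g x) (mg : measurable_fun [set: X] g)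
  (mk : forall U, measurable U -> measurable_fun [set: X] (k ^~ U)).

(** Integration against the image under [k] of the measure with density [g], kept as an iterated
    integral so that this measure need not be built. The next three lemmas are the closure clauses
    of [ge0_measurable_ind] for it. *)
Let I (f : Y -> \bar R) := \int[mu]_x (g x * \int[k x]_y f y).

Let m1 f : (forall y, 0 <= f y) -> measurable_fun [set: Y] f ->
  measurable_fun [set: X] (fun x => g x * \int[k x]_y f y).
Proof.
move=> f0 mf; apply: emeasurable_funM => //.
exact: measurable_fun_integral_kernel.
Qed.

Let I1 f x : (forall y, 0 <= f y) -> 0 <= g x * \int[k x]_y f y.
Proof. by move=> f0; rewrite mule_ge0// integral_ge0. Qed.

Lemma kernel_integralZl (r : R) f : (0 <= r)%R -> (forall y, 0 <= f y) ->
  measurable_fun [set: Y] f -> I (fun y => r%:E * f y) = r%:E * I f.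
Proof.
move=> r0 f0 mf; rewrite /I -ge0_integralZl//; last 2 first.
- exact: m1.
- by move=> x _; exact: I1.
by apply: eq_integral => x _; rewrite ge0_integralZl// muleCA.
Qed.

Lemma kernel_integralD f h :
  (forall y, 0 <= f y) -> measurable_fun [set: Y] f ->
  (forall y, 0 <= h y) -> measurable_fun [set: Y] h ->
  I (fun y => f y + h y) = I f + I h.
Proof.
move=> f0 mf h0 mh; rewrite /I -ge0_integralD//; last 4 first.
- by move=> x _; exact: I1.
- exact: m1.
- by move=> x _; exact: I1.
- exact: m1.
apply: eq_integral => x _; rewrite ge0_integralD//.
by rewrite ge0_muleDr// integral_ge0.
Qed.

Lemma kernel_integral_lim (f : nat -> Y -> \bar R) :
  (forall n y, 0 <= f n y) -> (forall n, measurable_fun [set: Y] (f n)) ->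
  (forall y, nondecreasing_seq (f ^~ y)) ->
  I (fun y => limn (f ^~ y)) = limn (fun n => I (f n)).
Proof.
move=> f0 mf ndf.
have nd x : nondecreasing_seq (fun n => \int[k x]_y f n y).
  by move=> m n mn; apply: ge0_le_integral => // y _; exact: ndf.
rewrite /I -monotone_convergence//; last 3 first.
- by move=> n; exact: m1.
- by move=> n x _; exact: I1.
- by move=> x _ m n mn; apply: lee_wpmul2l => //; exact: nd.
apply: eq_integral => x _; rewrite monotone_convergence//.
apply/esym/ge0_nondecreasing_limeMl => //.
by move=> n; rewrite integral_ge0.
Qed.

End kernel_functional.

(** Two such functionals that agree on indicators agree on all nonnegative measurable functions.
    Every later passage from sets to functions for detailed balance and the Markov property goes
    through this lemma. *)
Lemma eq_kernel_integral {dX dX' dY : measure_display} {X : measurableType dX}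
    {X' : measurableType dX'} {Y : measurableType dY} {R : realType}
    (mu : {measure set X -> \bar R}) (g : X -> \bar R)
    (k : X -> {measure set Y -> \bar R})
    (mu' : {measure set X' -> \bar R}) (g' : X' -> \bar R)
    (k' : X' -> {measure set Y -> \bar R}) :
  (forall x, 0 <= g x) -> measurable_fun [set: X] g ->
  (forall C, measurable C -> measurable_fun [set: X] (k ^~ C)) ->
  (forall x, 0 <= g' x) -> measurable_fun [set: X'] g' ->
  (forall C, measurable C -> measurable_fun [set: X'] (k' ^~ C)) ->
  (forall C, measurable C ->
    \int[mu]_x (g x * k x C) = \int[mu']_x (g' x * k' x C)) ->
  forall f, (forall y, 0 <= f y) -> measurable_fun [set: Y] f ->
    \int[mu]_x (g x * \int[k x]_y f y) = \int[mu']_x (g' x * \int[k' x]_y f y).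
Proof.
move=> g0 mg mk g'0 mg' mk' kk'; apply: ge0_measurable_ind.
- move=> C mC.
  under eq_integral do rewrite integral_indic// setIT.
  under [RHS]eq_integral do rewrite integral_indic// setIT.
  exact: kk'.
- by move=> r f r0 f0 mf ih; rewrite !kernel_integralZl// ih.
- by move=> f h f0 mf h0 mh fE hE; rewrite !kernel_integralD// fE hE.
- move=> f f0 mf ndf ih; rewrite !kernel_integral_lim//.
  by under eq_fun do rewrite ih.
Qed.

End kernel_integral.

(** * Self-adjointness of the transition operator under detailed balance *)

Section transition.
Local Open Scope ereal_scope.
Context {d : measure_display} {E : measurableType d} {R : realType}.
Implicit Types (P : R.-pker E ~> E) (pi : probability E R) (f g : E -> \bar R).

Definition markov_op P f : E -> \bar R := fun x => \int[P x]_y f y.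

Lemma markov_op_ge0 P f : (forall x, 0 <= f x) ->
  forall x, 0 <= markov_op P f x.
Proof. by move=> f0 x; exact: integral_ge0. Qed.

Lemma measurable_markov_op P f : (forall x, 0 <= f x) ->
  measurable_fun [set: E] f -> measurable_fun [set: E] (markov_op P f).
Proof.
move=> f0 mf; apply: measurable_fun_integral_kernel => // U.
exact: measurable_kernel.
Qed.

Lemma iter_markov_op_ge0 P n f : (forall x, 0 <= f x) ->
  forall x, 0 <= iter n (markov_op P) f x.
Proof. by move=> f0; elim: n => //= n; exact: markov_op_ge0. Qed.

Lemma measurable_iter_markov_op P n f : (forall x, 0 <= f x) ->
  measurable_fun [set: E] f -> measurable_fun [set: E] (iter n (markov_op P) f).
Proof.
move=> f0 mf; elim: n => //= n.
by apply: measurable_markov_op; exact: iter_markov_op_ge0.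
Qed.

(** Makes evaluation along [h] a deterministic kernel, so that a plain value [f (h x)] can be fed to
    [eq_kernel_integral]. *)
Lemma measurable_dirac_comp {d'} {X : measurableType d'} (h : X -> E) :
  measurable_fun [set: X] h -> forall C, measurable C ->
  measurable_fun [set: X] (fun x => \d_(h x) C : \bar R).
Proof.
move=> mh C mC; rewrite /dirac.
by apply/measurable_EFinP; exact: measurableT_comp.
Qed.

Lemma mul_indic_integral pi (C : set E) f : measurable C ->
  \int[pi]_x ((\1_C x)%:E * f x) = \int[pi]_(x in C) f x.
Proof.
move=> mC; rewrite [RHS]integral_mkcond; apply: eq_integral => x _.
by rewrite epatch_indic muleC.
Qed.

(** Once [g x] is written as an integral against the Dirac mass at [x], both sides are kernel
    integrals of [g], and on indicators they are related by detailed balance. *)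
Lemma detailed_balance_indicl P pi (C : set E) g : detailed_balance P pi ->
  measurable C -> (forall x, 0 <= g x) -> measurable_fun [set: E] g ->
  \int[pi]_x ((\1_C x)%:E * markov_op P g x) = \int[pi]_x (P x C * g x).
Proof.
move=> db mC g0 mg.
under [RHS]eq_integral => x _.
  rewrite -[g x]mul1e -[1](@diracT _ E R x) -integral_dirac//. over.
apply: (eq_kernel_integral pi (fun x => (\1_C x)%:E) P pi (P ^~ C)
  (fun x => \d_x)) => //.
- by apply/measurable_EFinP; exact: measurable_indic.
- by move=> U; exact: measurable_kernel.
- exact: measurable_kernel.
- exact: (measurable_dirac_comp id).
move=> D mD; rewrite mul_indic_integral// db// -mul_indic_integral//.
by apply: eq_integral => x _; rewrite muleC.
Qed.

(** The same device, now applied to [f]: the case of an indicator in place of [f] is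
    [detailed_balance_indicl]. *)
Lemma detailed_balance_integral P pi f g : detailed_balance P pi ->
  (forall x, 0 <= f x) -> measurable_fun [set: E] f ->
  (forall x, 0 <= g x) -> measurable_fun [set: E] g ->
  \int[pi]_x (f x * markov_op P g x) = \int[pi]_x (markov_op P f x * g x).
Proof.
move=> db f0 mf g0 mg.
under eq_integral => x _.
  rewrite muleC -[f x]mul1e -[1](@diracT _ E R x) -integral_dirac//. over.
under [RHS]eq_integral do rewrite muleC.
apply: (eq_kernel_integral pi (markov_op P g) (fun x => \d_x) pi g P) => //.
- exact: markov_op_ge0.
- exact: measurable_markov_op.
- exact: (measurable_dirac_comp id).
- by move=> U; exact: measurable_kernel.
move=> C mC; under eq_integral do rewrite muleC.
rewrite detailed_balance_indicl//.
by apply: eq_integral => x _; rewrite muleC.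
Qed.

(** The operators are moved across one at a time; the induction must be general in [f], which each
    step replaces by [markov_op P f]. *)
Lemma detailed_balance_iter P pi n f g : detailed_balance P pi ->
  (forall x, 0 <= f x) -> measurable_fun [set: E] f ->
  (forall x, 0 <= g x) -> measurable_fun [set: E] g ->
  \int[pi]_x (f x * iter n (markov_op P) g x) =
  \int[pi]_x (iter n (markov_op P) f x * g x).
Proof.
move=> db f0 mf g0 mg; elim: n f f0 mf => //= n ih f f0 mf.
rewrite detailed_balance_integral//; last 2 first.
- exact: iter_markov_op_ge0.
- exact: measurable_iter_markov_op.
rewrite ih -?iterSr//; first exact: markov_op_ge0.
exact: measurable_markov_op.
Qed.

End transition.

(** * Law of the process at a fixed time *)

Section law.
Local Open Scope ereal_scope.
Context {dE dO : measure_display} {E : measurableType dE}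
  {Omega : measurableType dO} {R : realType}.
Variables (P : R.-pker E ~> E) (Pr : R.-pker E ~> Omega)
  (X : nat -> {mfun Omega >-> E}).
Hypothesis hX : markov_process P Pr X.

Lemma process_law0 x f : (forall y, 0 <= f y) -> measurable_fun [set: E] f ->
  \int[Pr x]_w f (X 0%N w) = f x.
Proof.
move=> f0 mf; have mX0 : measurable_fun setT (X 0%N) by [].
transitivity (\int[pushforward (Pr x) (X 0%N)]_y f y).
  by rewrite ge0_integral_pushforward.
rewrite (eq_measure_integral (\d_x)); last by move=> C mC _; exact: hX.1.
by rewrite integral_dirac// diracT mul1e.
Qed.

(** The Markov property with an unconstrained past (every [C k] the full space) gives the case of an
    indicator; viewing [f (X m.+1 w)] as a Dirac integral extends it to functions. *)
Lemma process_lawS x m f : (forall y, 0 <= f y) -> measurable_fun [set: E] f ->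
  \int[Pr x]_w f (X m.+1 w) = \int[Pr x]_w markov_op P f (X m w).
Proof.
move=> f0 mf.
transitivity (\int[Pr x]_w (cst 1 w * \int[\d_(X m.+1 w)]_y f y)).
  by apply: eq_integral => w _; rewrite mul1e integral_dirac// diracT mul1e.
transitivity (\int[Pr x]_w (cst 1 w * \int[P (X m w)]_y f y)); last first.
  by apply: eq_integral => w _; rewrite mul1e.
apply: (eq_kernel_integral (Pr x) (cst 1) (fun w => \d_(X m.+1 w)) (Pr x)
  (cst 1) (fun w => P (X m w))) => //.
- by apply: measurable_dirac_comp.
- by move=> C mC; exact: (measurableT_comp (measurable_kernel P C mC)).
move=> D mD; transitivity (Pr x (X m.+1 @^-1` D)).
  have mXD : measurable (X m.+1 @^-1` D).
    by rewrite -[_ @^-1` _]setTI; exact: measurable_funPT.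
  rewrite -[X in _ = Pr x X]setIT -integral_indic//.
  by apply: eq_integral => w _; rewrite mul1e.
have := hX.2 x m (fun=> setT) D (fun=> measurableT) mD.
rewrite /= (_ : [set w | _] = setT); last by apply/seteqP; split.
by rewrite setTI => ->; apply: eq_integral => w _; rewrite mul1e.
Qed.

Lemma process_law x n f : (forall y, 0 <= f y) -> measurable_fun [set: E] f ->
  \int[Pr x]_w f (X n w) = iter n (markov_op P) f x.
Proof.
elim: n f => [|n ih] f f0 mf; first exact: process_law0.
rewrite process_lawS// ih ?iterSr//; first exact: markov_op_ge0.
exact: measurable_markov_op.
Qed.

End law.

(** * Joint law of the initial and final positions *)

Section joint_law.
Local Open Scope ereal_scope.
Context {dE dO : measure_display} {E : measurableType dE}
  {Omega : measurableType dO} {R : realType}.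
Variables (P : R.-pker E ~> E) (Pr : R.-pker E ~> Omega)
  (X : nat -> {mfun Omega >-> E}) (pi : probability E R) (n : nat).
Hypothesis hX : markov_process P Pr X.

Lemma measurable_process_preimage m (C : set E) : measurable C ->
  measurable (X m @^-1` C).
Proof. by move=> mC; rewrite -[_ @^-1` _]setTI; exact: measurable_funPT. Qed.

(** Under [Pr x] the event that the initial position lies in [C] has probability 0 or 1, so
    intersecting with it either kills an event or leaves its probability unchanged. *)
Lemma process_joint x (C D : set E) : measurable C -> measurable D ->
  Pr x (X 0%N @^-1` C `&` X n @^-1` D) = (\1_C x)%:E * Pr x (X n @^-1` D).
Proof.
move=> mC mD; have mC0 := measurable_process_preimage 0 _ mC.
have mDn := measurable_process_preimage n _ mD.
have C0 : Pr x (X 0%N @^-1` C) = \d_x C by exact: hX.1.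
rewrite indicE; case: (boolP (x \in C)) => xC; last first.
  rewrite mul0e; apply: (subset_measure0 _ mC0) => //; first exact: measurableI.
  by apply: (eq_trans C0); rewrite diracE (negbTE xC).
rewrite mul1e setIC; apply/esym.
have mCc : measurable (~` (X 0%N @^-1` C)) by exact: measurableC.
have Cc0 : Pr x (~` (X 0%N @^-1` C)) = 0.
  rewrite preimage_setC hX.1; last exact: measurableC.
  by rewrite diracE in_setC xC.
rewrite -[in LHS](setIT (X n @^-1` D)) -(setUv (X 0%N @^-1` C)) setIUr.
rewrite measureU//; [|exact: measurableI|exact: measurableI|]; last first.
  by rewrite setIACA setICr setI0.
rewrite [X in _ + X](@subset_measure0 _ _ _ _ _ (~` (X 0%N @^-1` C))) ?adde0//.
exact: measurableI.
Qed.

Lemma process_law_setE x (D : set E) : measurable D ->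
  Pr x (X n @^-1` D) = iter n (markov_op P) (EFin \o \1_D) x.
Proof.
move=> mD; rewrite -(process_law _ _ _ hX); last 2 first.
- by move=> y /=; rewrite lee_fin.
- exact/measurable_EFinP.
rewrite -[X in Pr x X]setIT -integral_indic//.
exact: measurable_process_preimage.
Qed.

Lemma measurable_process_law (D : set E) : measurable D ->
  measurable_fun [set: E] (fun x => Pr x (X n @^-1` D)).
Proof.
by move=> mD; apply: measurable_kernel; exact: measurable_process_preimage.
Qed.

(** By [process_joint], the probability of starting in [C] and ending in [D] when the start has law
    [pi]; the factored form is also the numerator of [msm_matrix]. *)
Definition transition_mass (C D : set E) : \bar R :=
  \int[pi]_x ((\1_C x)%:E * Pr x (X n @^-1` D)).

Lemma transition_mass_integrand_ge0 (C D : set E) x :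
  0 <= (\1_C x)%:E * Pr x (X n @^-1` D).
Proof. by rewrite mule_ge0// lee_fin. Qed.

Lemma measurable_transition_mass_integrand (C D : set E) :
  measurable C -> measurable D ->
  measurable_fun [set: E] (fun x => (\1_C x)%:E * Pr x (X n @^-1` D)).
Proof.
move=> mC mD; apply: emeasurable_funM; last exact: measurable_process_law.
exact/measurable_EFinP.
Qed.

Lemma transition_mass_ge0 C D : 0 <= transition_mass C D.
Proof. by apply: integral_ge0 => x _; exact: transition_mass_integrand_ge0. Qed.

Lemma transition_mass_fin_num C D : measurable C -> measurable D ->
  transition_mass C D \is a fin_num.
Proof.
move=> mC mD; rewrite ge0_fin_numE ?transition_mass_ge0//.
apply: (@le_lt_trans _ _ (\int[pi]_x (\1_C x)%:E)); last first.
  rewrite integral_indic// setIT.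
  by rewrite (le_lt_trans (probability_le1 _ _)) ?ltry.
apply: ge0_le_integral => //.
- exact: measurable_transition_mass_integrand.
- exact/measurable_EFinP.
move=> x _; rewrite -[leRHS]mule1 lee_wpmul2l ?lee_fin//.
rewrite -(prob_kernel (s := Pr) x).
apply: le_measure => //; apply/mem_set => //.
exact: measurable_process_preimage.
Qed.

(** Self-adjointness of the [n]-step operator, tested on the two indicators. *)
Lemma transition_massC C D : detailed_balance P pi ->
  measurable C -> measurable D -> transition_mass C D = transition_mass D C.
Proof.
move=> db mC mD; rewrite /transition_mass.
under eq_integral do rewrite process_law_setE//.
under [RHS]eq_integral do rewrite process_law_setE// muleC.
apply: (detailed_balance_iter P pi n (EFin \o \1_C) (EFin \o \1_D)) => //.
- by move=> x /=; rewrite lee_fin.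
- exact/measurable_EFinP.
- by move=> x /=; rewrite lee_fin.
- exact/measurable_EFinP.
Qed.

End joint_law.

(** * Step functions on a partition *)

Section partition.
Context {d : measure_display} {E : measurableType d} {R : realType}
  (K : nat) (S : 'I_K -> set E).
Hypotheses (tS : trivIset [set: 'I_K] S) (cS : \bigcup_j S j = [set: E]).

Lemma partition_indic x :
  exists2 i, S i x & forall j, \1_(S j) x = (j == i)%:R :> R.
Proof.
have [i _ Six] : (\bigcup_j S j) x by rewrite cS.
exists i => // j; rewrite indicE; congr (_%:R); congr nat_of_bool.
apply/idP/eqP => [/set_mem Sjx|->]; last exact/mem_set.
by apply: tS => //; exists x.
Qed.

Lemma indicator_sumE (c : 'cV[R]_K) x i : S i x -> indicator_sum S c x = c i 0.
Proof.
move=> Six; have [k Skx Sx] := partition_indic x.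
have -> : i = k by apply: tS => //; exists x.
rewrite /indicator_sum (bigD1 k)//= Sx eqxx mulr1 big1 ?addr0// => j jk.
by rewrite Sx (negbTE jk) mulr0.
Qed.

(** Exactly one pair of states contains the pair of points, so a single term of the double sum
    survives. Each term is a product in [x] and [y], ready for integration. *)
Lemma indicator_sum_sqrB (c : 'cV[R]_K) x y :
  (indicator_sum S c y - indicator_sum S c x) ^+ 2 =
  \sum_i \sum_j (c j 0 - c i 0) ^+ 2 * (\1_(S i) x * \1_(S j) y).
Proof.
have [i Six Sx] := partition_indic x; have [j Sjy Sy] := partition_indic y.
rewrite (indicator_sumE c x i Six) (indicator_sumE c y j Sjy).
rewrite (bigD1 i)//= [X in _ = _ + X]big1 => [|k ki]; last first.
  by apply: big1 => l _; rewrite Sx (negbTE ki) mul0r mulr0.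
rewrite addr0 (bigD1 j)//= [X in _ = _ + X]big1 => [|l lj]; last first.
  by rewrite Sy (negbTE lj) !mulr0.
by rewrite addr0 Sx Sy !eqxx !mulr1.
Qed.

End partition.

(** * The mass matrix, the Markov state model and the functional *)

Section msm.
Context {dE dO : measure_display} {E : measurableType dE}
  {Omega : measurableType dO} {R : realType}.
Variables (P : R.-pker E ~> E) (Pr : R.-pker E ~> Omega)
  (X : nat -> {mfun Omega >-> E}) (pi : probability E R) (n : nat)
  (K : nat) (S : 'I_K -> set E).
Hypotheses (hX : markov_process P Pr X) (mS : forall j, measurable (S j))
  (tS : trivIset [set: 'I_K] S) (cS : \bigcup_j S j = [set: E]).

Definition mass_matrix : 'M[R]_K :=
  \matrix_(i, j) fine (transition_mass Pr X pi n (S i) (S j)).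

Lemma mass_matrixE i j :
  (mass_matrix i j)%:E = transition_mass Pr X pi n (S i) (S j).
Proof. by rewrite mxE fineK// transition_mass_fin_num. Qed.

Lemma mass_matrix_ge0 i j : 0 <= mass_matrix i j.
Proof. by rewrite -lee_fin mass_matrixE transition_mass_ge0. Qed.

Lemma mass_matrix_sym : detailed_balance P pi -> mass_matrix^T = mass_matrix.
Proof.
move=> db; apply/matrixP => i j; rewrite !mxE.
by rewrite (transition_massC P Pr X pi n hX _ _ db).
Qed.

Lemma sum_process_law x : (\sum_j Pr x (X n @^-1` S j) = 1)%E.
Proof.
have mXS j : measurable (X n @^-1` S j) by exact: measurable_process_preimage.
transitivity (\int[Pr x]_w (\sum_j (\1_(X n @^-1` S j) w)%:E))%E.
  rewrite ge0_integral_sum//.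
  - by apply: eq_bigr => j _; rewrite integral_indic// setIT.
  - by move=> j; exact/measurable_EFinP.
under eq_integral => w _.
  rewrite sumEFin.
  have [i _ Si] := partition_indic (R := R) K S tS cS (X n w).
  rewrite (_ : \sum_j _ = 1)%R; last first.
    rewrite (bigD1 i)//= big1 ?addr0 => [|j ji].
      by rewrite -[LHS]/(\1_(S i) (X n w)) Si eqxx.
    by rewrite -[LHS]/(\1_(S j) (X n w)) Si (negbTE ji).
  over.
by rewrite integral_cst//= mul1e prob_kernel.
Qed.

(** Since the states partition the space, summing over the final state leaves the marginal law of
    the initial one. *)
Lemma sum_mass_matrix i : (\sum_j mass_matrix i j)%:E = pi (S i).
Proof.
rewrite -sumEFin; under eq_bigr do rewrite mass_matrixE.
rewrite -ge0_integral_sum; last 3 first.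
- by [].
- by move=> j; exact: measurable_transition_mass_integrand.
- by move=> j x _; exact: transition_mass_integrand_ge0.
rewrite -[X in _ = pi X]setIT -integral_indic//; apply: eq_integral => x _.
by rewrite -ge0_sume_distrr// sum_process_law mule1.
Qed.

(** This includes states of mass zero, where both quotients are 0 by the convention for division by
    zero. *)
Lemma msm_matrixE i j :
  msm_matrix (transition_operator Pr X n) pi S i j =
  mass_matrix i j / fine (pi (S i)).
Proof.
rewrite mxE /Rintegral; congr (_ / fine _); last first.
  by rewrite integral_indic// setIT.
rewrite mxE; congr fine; apply: eq_integral => x _.
have mXS : measurable (X n @^-1` S j) by exact: measurable_process_preimage.
rewrite EFinM /transition_operator /Rintegral; congr (_ * _)%E.
rewrite (_ : (\int[Pr x]_w _)%E = Pr x (X n @^-1` S j)).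
  (* A probability is at most 1, so passing to the real-valued integral loses nothing. *)
  rewrite fineK// ge0_fin_numE// (@le_lt_trans _ _ 1%E) ?ltry//.
  rewrite -(prob_kernel (s := Pr) x).
  by apply: le_measure => //; apply/mem_set.
by rewrite -[in RHS](setIT (X n @^-1` S j)) -integral_indic.
Qed.

Lemma dirichlet_indicator_sum (c : 'cV[R]_K) :
  dirichlet Pr X pi n (indicator_sum S c) = (edge_energy mass_matrix c)%:E.
Proof.
have mXS m j : measurable (X m @^-1` S j) by exact: measurable_process_preimage.
have mI i j : measurable_fun [set: Omega]
    (fun w => \1_(S i) (X 0%N w) * \1_(S j) (X n w) : R).
  apply: measurable_funM; first exact: (measurable_indic (mXS 0%N i)).
  exact: (measurable_indic (mXS n j)).
rewrite /dirichlet /expectation_from.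
(* The integral over paths is computed first, for a fixed start; nonnegativity of all terms allows
   both sums to leave it, and [process_joint] evaluates each term. *)
transitivity (\int[pi]_x \sum_i \sum_j ((c j 0 - c i 0) ^+ 2)%:E *
    ((\1_(S i) x)%:E * Pr x (X n @^-1` S j)))%E.
  apply: eq_integral => x _.
  under eq_integral => w _.
    rewrite (indicator_sum_sqrB K S tS cS) -sumEFin.
    under eq_bigr do rewrite -sumEFin. over.
  rewrite ge0_integral_sum//=; last 2 first.
  - move=> i; apply: emeasurable_sum => j; apply/measurable_EFinP.
    exact: measurable_funM.
  - move=> i w _; apply: sume_ge0 => j _.
    by rewrite lee_fin mulr_ge0// sqr_ge0.
  apply: eq_bigr => i _; rewrite ge0_integral_sum//=; last 2 first.
  - move=> j; apply/measurable_EFinP.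
    exact: measurable_funM.
  - by move=> j w _; rewrite lee_fin mulr_ge0// sqr_ge0.
  apply: eq_bigr => j _; under eq_integral do rewrite EFinM.
  rewrite ge0_integralZl; last 4 first.
  - by [].
  - exact/measurable_EFinP.
  - by move=> w _; rewrite lee_fin mulr_ge0.
  - by rewrite lee_fin sqr_ge0.
  congr (_ * _)%E; rewrite -(process_joint P Pr X n hX)//.
  rewrite -[in RHS](setIT (_ `&` _)) -integral_indic//; last exact: measurableI.
  by apply: eq_integral => w _; rewrite indicI.
rewrite ge0_integral_sum//=; last 2 first.
- move=> i; apply: emeasurable_sum => j; apply: measurable_funeM.
  exact: measurable_transition_mass_integrand.
- move=> i x _; apply: sume_ge0 => j _; apply: mule_ge0.
    by rewrite lee_fin sqr_ge0.
  exact: transition_mass_integrand_ge0.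
rewrite -sumEFin; apply: eq_bigr => i _.
rewrite ge0_integral_sum//=; last 2 first.
- move=> j; apply: measurable_funeM.
  exact: measurable_transition_mass_integrand.
- move=> j x _; apply: mule_ge0; first by rewrite lee_fin sqr_ge0.
  exact: transition_mass_integrand_ge0.
rewrite -sumEFin; apply: eq_bigr => j _; rewrite ge0_integralZl; last 4 first.
- by [].
- exact: measurable_transition_mass_integrand.
- by move=> x _; exact: transition_mass_integrand_ge0.
- by rewrite lee_fin sqr_ge0.
by rewrite [RHS]EFinM mass_matrixE.
Qed.

End msm.

(** * Boundary conditions in terms of coefficients *)

Section trial_functions.
Context {d : measure_display} {E : measurableType d} {R : realType}
  (A B : set E) (K : nat) (S : 'I_K -> set E).
Hypotheses (hAB : A `&` B = set0) (hS : markov_states A B S).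

Definition boundary_values (c : 'cV[R]_K) : Prop :=
  forall i, (S i `<=` A -> c i 0 = 0) /\ (S i `<=` B -> c i 0 = 1).

(** A point of the nonempty state [S i] makes the alternatives exclusive; the classification of
    states makes them exhaustive. *)
Lemma outsideP i : outside A B (S i) <-> ~ (S i `<=` A \/ S i `<=` B).
Proof.
case: hS => _ /(_ i) [x Six] _ _ /(_ i) SAB; split.
  move=> /seteqP[out _] [] Ssub; apply: (out x); split => //.
  - by left; exact: Ssub.
  - by right; exact: Ssub.
by case: SAB => // ? []; [left|right].
Qed.

(** A coefficient is read off at a point of its state. Conversely, a state meeting [A] must lie
    inside [A]: it cannot lie in [B], which is disjoint from [A], nor be outside both; likewise for
    [B]. *)
Lemma trial_functionsP (c : 'cV[R]_K) :
  trial_functions A B S (indicator_sum S c) <-> boundary_values c.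
Proof.
case: hS => _ S0 tS cS SAB; split.
  move=> [_ vA vB] i; have [x Six] := S0 i.
  rewrite -(indicator_sumE K S tS cS c x i Six).
  by split=> Ssub; [apply: vA|apply: vB]; exact: Ssub.
move=> cAB; split; first by exists c.
- move=> x Ax; have [i Six _] := partition_indic (R := R) K S tS cS x.
  rewrite (indicator_sumE K S tS cS c x i Six).
  case: (SAB i) => [|SB|out]; first exact: (cAB i).1.
    by have : (A `&` B) x := conj Ax (SB _ Six); rewrite hAB.
  by have : (S i `&` (A `|` B)) x := conj Six (or_introl Ax); rewrite out.
- move=> x Bx; have [i Six _] := partition_indic (R := R) K S tS cS x.
  rewrite (indicator_sumE K S tS cS c x i Six).
  case: (SAB i) => [SA||out]; last 2 first.
  - exact: (cAB i).2.
  - by have : (S i `&` (A `|` B)) x := conj Six (or_intror Bx); rewrite out.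
  by have : (A `&` B) x := conj (SA _ Six) Bx; rewrite hAB.
Qed.

(** Relative to one admissible [q], the constraints take the form used by [edge_energy_minimizerP],
    the free coordinates being the states outside [A] and [B]. *)
Lemma boundary_valuesP (q c : 'cV[R]_K) : boundary_values q ->
  boundary_values c <-> (forall i, ~ outside A B (S i) -> c i 0 = q i 0).
Proof.
move=> hq; split=> [hc i|cq i].
  by rewrite outsideP => /contrapT[] Ssub;
    rewrite ?(proj1 (hc i) Ssub) ?(proj1 (hq i) Ssub)
            ?(proj2 (hc i) Ssub) ?(proj2 (hq i) Ssub).
split=> Ssub; rewrite cq.
- exact: (hq i).1.
- by rewrite outsideP => /(_ (or_introl Ssub)).
- exact: (hq i).2.
- by rewrite outsideP => /(_ (or_intror Ssub)).
Qed.

End trial_functions.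

Theorem mainTheorem3 (R : realType) (dE dO : measure_display)
    (E : measurableType dE) (Omega : measurableType dO)
    (P : R.-pker E ~> E) (Pr : R.-pker E ~> Omega)
    (X : nat -> {mfun Omega >-> E}) (pi : probability E R) (n : nat)
    (A B : set E) (K : nat) (S : 'I_K -> set E)
    (hX : markov_process P Pr X)
    (hpi : equilibrium P pi)
    (hAB : A `&` B = set0)
    (hS : markov_states A B S)
    (hpos : forall i, outside A B (S i) -> (0 < pi (S i))%E) :
  forall q : 'cV[R]_K,
    is_minimizer (trial_functions A B S) (dirichlet Pr X pi n)
      (indicator_sum S q)
    <->
    msm_committor A B S (msm_matrix (transition_operator Pr X n) pi S) q.
Proof.
move=> q; have [mS _ tS cS _] := hS; have [_ db] := hpi.
pose M := mass_matrix Pr X pi n K S.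
have M0 : forall i j, 0 <= M i j by move=> i j; exact: mass_matrix_ge0.
have symM : M^T = M by exact: (mass_matrix_sym P).
have dirE c : dirichlet Pr X pi n (indicator_sum S c) = (edge_energy M c)%:E.
  exact: (dirichlet_indicator_sum P).
(* The row sum p of [M] is [pi (S i)], positive by [hpos], so the equation can be divided by p to
   turn [M i j] into the entry of the transition matrix. *)
have committor_row i : outside A B (S i) ->
    \sum_j M i j * (q j 0 - q i 0) = 0 <->
    q i 0 = \sum_j msm_matrix (transition_operator Pr X n) pi S i j * q j 0.
  move=> /hpos; rewrite -(sum_mass_matrix Pr X pi n K S mS tS cS) lte_fin.
  move=> p0; under [in X in _ <-> X]eq_bigr => j _.
    rewrite (msm_matrixE Pr X pi n K S mS).
    rewrite -(sum_mass_matrix Pr X pi n K S mS tS cS) /= mulrAC. over.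
  rewrite -mulr_suml; under [X in X = 0 <-> _]eq_bigr do rewrite mulrBr.
  rewrite sumrB -mulr_suml -/M; set p := \sum_j M i j.
  have pn0 : p != 0 by rewrite gt_eqF.
  split=> [/eqP|->]; last by rewrite mulrC divfK// subrr.
  by rewrite subr_eq0 => /eqP->; rewrite mulrAC divff// mul1r.
(* Both sides are compared with the boundary conditions plus vanishing of the derivative in each
   free coordinate. *)
transitivity (boundary_values A B K S q /\
    forall i, outside A B (S i) -> \sum_j M i j * (q j 0 - q i 0) = 0).
  split=> [[/(trial_functionsP A B K S hAB hS) hq qmin]|[hq qharm]].
    split=> //; apply/(edge_energy_minimizerP _ _ _ M0 symM) => c.
    move=> /(boundary_valuesP A B K S hS _ _ hq) hc.
    rewrite -lee_fin -!dirE; apply: qmin.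
    exact/(trial_functionsP A B K S hAB hS).
  split; first exact/(trial_functionsP A B K S hAB hS).
  (* Any competitor is itself an indicator sum, so comparing energies of coefficient vectors
     suffices. *)
  move=> w Dw; have [[c wE] _ _] := Dw; rewrite wE in Dw *.
  rewrite !dirE lee_fin.
  have [_] := edge_energy_minimizerP M (fun i => outside A B (S i)) q M0 symM.
  apply => //.
  apply/(boundary_valuesP A B K S hS _ _ hq).
  exact/(trial_functionsP A B K S hAB hS).
split=> [[hq qharm] i|hq].
  split; [exact: (hq i).1|exact: (hq i).2|].
  by move=> out; apply/committor_row => //; exact: qharm.
split=> i; first by have [? ? _] := hq i.
by move=> out; apply/committor_row => //; have [_ _] := hq i; apply.
Qed.
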